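(* Let $n\ge 1$ and $1\le m\le n$ be integers and consider the rectangular flag-shaped blocker $B_n(m,m-1)$ of all $n\times n$ $123$-avoiding permutation matrices (here $t=m-1$). Then the face of $\Omega_n(\overline{123})$ determined by $B_n(m,m-1)$ attains the maximum dimension $(n-1)^2+1-t(n-m)=(n-1)^2+1-(m-1)(n-m)$; that is, the maximum number of linearly independent (as real $n\times n$ matrices) $n\times n$ $123$-avoiding permutation matrices each having exactly one $1$ in a position of $B_n(m,m-1)$ equals $(n-1)^2+1-(m-1)(n-m)$.
   Context: A permutation matrix $P$ contains a $123$-pattern if $I_3$ is a submatrix of $P$; otherwise $P$ is $123$-avoiding. $\Omega_n(\overline{123})$ denotes the convex hull of the $n\times n$ $123$-avoiding permutation matrices. A set of positions is a blocker if every $n\times n$ $123$-avoiding permutation matrix has a $1$ in one of its positions. In this paper, the dimension of the face of $\Omega_n(\overline{123})$ determined by a minimum blocker $Q$ is taken to be the maximum number of linearly independent $123$-avoiding permutation matrices having exactly one $1$ in a position of $Q$. For integers $1\le m\le n$, $0\le t\le m-1$, the flag-shaped blocker $B_n(m,t)$ is the union of $\{(i,m): 1\le i\le n-t\}$ and $\{(i,j): 1\le i\le n-m+1,\ m-t\le j\le m-1\}$, positions written as (row, column); thus $B_n(m,m-1)$ is the rectangle of rows $1,\dots,n-m+1$ and columns $1,\dots,m$. *)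

(* Defs.v *)
From mathcomp Require Import all_boot all_order all_fingroup all_algebra.
From mathcomp Require Import reals.
Set Implicit Arguments.
Unset Strict Implicit.
Unset Printing Implicit Defensive.

Definition strictly_increasing (k n : nat) (f : {ffun 'I_k -> 'I_n}) : bool :=
  [forall a : 'I_k, forall b : 'I_k, (a < b) ==> (f a < f b)].

Definition contains123 (R : realType) (n : nat) (P : 'M[R]_n) : bool :=
  [exists f : {ffun 'I_3 -> 'I_n}, exists g : {ffun 'I_3 -> 'I_n},
    [&& strictly_increasing f, strictly_increasing g
      & mxsub f g P == (1%:M)%R]].

Definition avoids123 (R : realType) (n : nat) (P : 'M[R]_n) : bool :=
  ~~ contains123 P.

Definition ones_in (R : realType) (n : nat) (P : 'M[R]_n)
    (Q : {set 'I_n * 'I_n}) : nat :=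
  #|[set p in Q | P p.1 p.2 == 1%R]|.

(* The permutation s stands for the matrix perm_mx s, whose 1s are at the
   positions (i, s i). *)
Definition face_perms (R : realType) (n : nat) (Q : {set 'I_n * 'I_n}) :
    {set 'S_n} :=
  [set s : 'S_n | avoids123 (perm_mx s : 'M[R]_n)
                & ones_in (perm_mx s : 'M[R]_n) Q == 1].

(* This is a linear dimension (that of the span of the vertices of the face),
   one more than the affine dimension of the face when it is nonempty. *)
Definition face_dim (R : realType) (n : nat) (Q : {set 'I_n * 'I_n}) : nat :=
  \max_(S : {set 'S_n} | (S \subset face_perms R Q)
                      && free [seq (perm_mx s : 'M[R]_n) | s <- enum S]) #|S|.

(* Positions are (row, column), numbered from 1 in the formula: the ordinal i
   stands for the index i.+1. *)
Definition flag_blocker (n m t : nat) : {set 'I_n * 'I_n} :=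
  [set p : 'I_n * 'I_n |
    ((p.1.+1 <= n - t) && (p.2.+1 == m))
    || ((p.1.+1 <= n - m + 1) && (m - t <= p.2.+1 <= m - 1))].

(* Main.v *)
Require Import Defs.
From mathcomp Require Import all_boot all_order all_fingroup all_algebra.
From mathcomp Require Import reals zify ring.

(* Write N = n - 1, q = m - 1, p = N - q and number rows and columns from 0.
   Counting the 1s of a permutation matrix by blocks, exactly one of them lies
   in the rectangle (rows <= p, columns <= q) if and only if none lies in the
   opposite corner (rows > p, columns > q).  So the face spans a space of
   matrices that vanish on that corner and have constant line sums; such a
   matrix is determined by its entries in the set [face_coords] of
   N^2 + 1 - p q positions, which is the upper bound.

   For the lower bound, let W be a functional vanishing on the face.  Take the
   permutation that is decreasing except in rows i <= N - 1 - j and k >= N - j,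
   which use columns j and j + 1: both ways of assigning these two columns avoid
   123, so W(i,j) - W(i,j+1) = W(k,j) - W(k,j+1).  The rows i and k form a
   complete bipartite graph, hence this difference does not depend on the row,
   and W(i,j) = x_i + y_j off the corner.  If moreover W is supported on
   [face_coords], it is a multiple of the indicator of row 0, and that multiple
   is its value at any permutation of the face, i.e. 0. *)

Set Implicit Arguments.
Unset Strict Implicit.
Unset Printing Implicit Defensive.
Import GRing.Theory.

(** * Maximal free families from coordinates *)

(** The hypotheses say that restriction to [T] is injective on the span of the family and that no
    nonzero functional on [T] kills all of it. In the matrix [M] of restrictions, the first bounds a
    free family by the number of columns; the second gives full column rank. *)
Lemma max_free_coordinates (K : fieldType) (I : finType) (m n : nat)
    (A : I -> 'M[K]_(m, n)) (F : {set I}) (T : {set 'I_m * 'I_n}) :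
    (forall (d : nat) (f : 'I_d -> I) (c : 'I_d -> K),
      (forall a, f a \in F) ->
      (forall t, t \in T -> (\sum_a c a *: A (f a))%R t.1 t.2 = 0%R) ->
      (\sum_a c a *: A (f a))%R = 0%R) ->
    (forall W : 'I_m * 'I_n -> K,
      (forall s, s \in F -> (\sum_(t in T) W t * A s t.1 t.2)%R = 0%R) ->
      forall t, t \in T -> W t = 0%R) ->
  \max_(S : {set I} | (S \subset F) && free [seq A s | s <- enum S]) #|S|
  = #|T|.
Proof.
move=> injT sepT; apply/eqP; rewrite eqn_leq; apply/andP; split.
  apply/bigmax_leqP => S /andP[/subsetP SF frS].
  pose M := (\matrix_(a < #|S|, b < #|T|)
    A (enum_val a) (enum_val b).1 (enum_val b).2)%R : 'M[K]_(_, _).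
  suff /eqP <- : row_free M by exact: rank_leq_col.
  apply: inj_row_free => v vM0; apply/rowP => a; rewrite mxE.
  have sz : size [seq A s | s <- enum S] == #|S| by rewrite size_map -cardE.
  have /freeP/(_ (v 0%R)) := frS : free (Tuple sz); apply.
  under eq_bigr => b _.
    have -> : ([seq A s | s <- enum S]`_b = A (enum_val b))%R.
      by rewrite (nth_map (enum_val b)) -?cardE // -enum_val_nth.
    over.
  apply: injT => [b|t tT]; first exact/SF/enum_valP.
  move/rowP/(_ (enum_rank_in tT t)): vM0; rewrite !mxE => e;
    rewrite -[RHS]e summxE.
  by apply: eq_bigr => b _; rewrite !mxE enum_rankK_in.
pose M := (\matrix_(a < #|F|, b < #|T|)
  A (enum_val a) (enum_val b).1 (enum_val b).2)%R : 'M[K]_(_, _).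
have fM : row_full M.
  rewrite /row_full -mxrank_tr; apply: inj_row_free => v vM0.
  apply/rowP => b; rewrite mxE.
  (* This sum has at most one term: it transports [v] to positions and is 0 outside [T]. *)
  pose W t := (\sum_(b < #|T| | enum_val b == t) v 0 b)%R.
  have WE c : W (enum_val c) = v 0%R c.
    by rewrite /W (big_pred1 c) // => d; rewrite (inj_eq enum_val_inj).
  rewrite -WE; apply: sepT (enum_valP b) => s sF.
  move/rowP/(_ (enum_rank_in sF s)): vM0; rewrite !mxE => e; rewrite -[RHS]e.
  rewrite big_enum_val; apply: eq_bigr => c _.
  by rewrite WE !mxE enum_rankK_in.
(* [fullrankfun] selects [#|T|] independent rows of [M], which index the free family. *)
pose g b := enum_val (fullrankfun fM b).
have gI : injective g by move=> b c /enum_val_inj/fullrankfun_inj.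
have gF b : g b \in F by exact: enum_valP.
have cg : #|[set g b | b : 'I_#|T|]| = #|T| by rewrite card_imset // card_ord.
rewrite -{1}cg; apply: leq_bigmax_cond; apply/andP; split.
  by apply/subsetP => _ /imsetP[b _ ->].
have pe : perm_eq [seq A s | s <- enum [set g b | b : 'I_#|T|]]
    (map_tuple (fun b => A (g b)) (ord_tuple #|T|)).
  rewrite /= (map_comp A g); apply: perm_map; apply: uniq_perm.
  - exact: enum_uniq.
  - by rewrite map_inj_uniq // enum_uniq.
  - move=> s; rewrite mem_enum; apply/imsetP/mapP => -[b _ ->]; exists b => //.
    by rewrite mem_enum.
rewrite (perm_free pe); apply/freeP => c c0 b.
have rf := fullrowsub_free fM.
have : (\row_b c b *m rowsub (fullrankfun fM) M =
  0 *m rowsub (fullrankfun fM) M)%R.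
  rewrite mul0mx; apply/rowP => t; rewrite !mxE.
  move/matrixP/(_ (enum_val t).1 (enum_val t).2): c0; rewrite mxE => e.
  rewrite -[RHS]e summxE; apply: eq_bigr => d _.
  by rewrite -tnth_nth tnth_map tnth_ord_tuple !mxE.
by move/(row_free_inj rf)/rowP/(_ b); rewrite !mxE.
Qed.

(** * Exchange permutations *)

(* Rows i and k are sent to columns u and v, and the other rows to the other
   columns in decreasing order (rows x < N - j to the columns > j + 1). *)
Definition exch (N j i k u v x : nat) : nat :=
  if x == i then u else if x == k then v
  else if x + j < N then (if i < x then (N - x).+1 else N - x)
  else (if x < k then (N - x).-1 else N - x).

(** Column [j + 1] meets the corner once [q <= j], so row [k] must then satisfy [k <= p]; row [i]
    does so by [i + j < N]. The disjunction treats both assignments of the two columns at once. *)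
Definition exch_admissible (N p q j i k u v : nat) : Prop :=
  [/\ p + q = N, i + j < N <= k + j, k <= N, q <= j -> k <= p &
      (u = j /\ v = j.+1) \/ (u = j.+1 /\ v = j)].

Section Exch.
Context {N p q j i k u v : nat} (adm : exch_admissible N p q j i k u v).
Local Notation f := (exch N j i k u v).

Lemma exch_le x : x <= N -> f x <= N.
Proof. by case: adm => *; rewrite /exch; repeat case: ifP => ?; lia. Qed.

Lemma exch_inj x y : x <= N -> y <= N -> f x = f y -> x = y.
Proof. by case: adm => ????? ??; rewrite /exch; repeat case: ifP => ?; lia. Qed.

Lemma exch_ascent x y : x < y -> y <= N -> f x < f y -> x = i \/ y = k.
Proof.
by case: adm => ????? ??; rewrite /exch; repeat case: ifP => ?; lia.
Qed.

(** By [exch_ascent], two consecutive ascents must start at row [i] and end at row [k]; their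
    columns are adjacent integers, with no room for a third value between. *)
Lemma exch_avoids x y z : x < y < z -> z <= N -> ~~ (f x < f y < f z).
Proof.
case/andP=> xy yz zN; apply/negP => /andP[fxy fyz].
have [ik fik] : i < k /\ ~~ (f i < f y < f k).
  case: adm => ?????; split; first lia.
  by rewrite /exch eqxx; repeat case: ifP => ?; lia.
have := exch_ascent xy (leq_trans (ltnW yz) zN) fxy.
have := exch_ascent yz zN fyz.
case=> e1 [] e2; try lia.
by move: fxy fyz fik; rewrite e2 e1 => -> ->.
Qed.

Lemma exch_corner x : p < x -> x <= N -> f x <= q.
Proof. by case: adm => *; rewrite /exch; repeat case: ifP => ?; lia. Qed.
End Exch.

(** * The face in terms of permutations *)

Lemma avoids123_perm_mx (R : realType) (n : nat) (s : 'S_n) :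
  (forall x y z : 'I_n, x < y < z -> ~~ (s x < s y < s z)) ->
  avoids123 (perm_mx s : 'M[R]_n).
Proof.
move=> h; apply/negP =>
  /existsP[f /existsP[g /and3P[/forallP incf /forallP incg /eqP/matrixP e]]].
have fg a : s (f a) = g a.
  apply/eqP; move: (e a a); rewrite !mxE !eqxx; case: eqP => // _ /eqP.
  by rewrite eq_sym oner_eq0.
have lt (a b : 'I_3) : a < b -> (f a < f b) * (s (f a) < s (f b)).
  by rewrite !fg => ab;
    move: (incf a) (incg a) => /forallP/(_ b) + /forallP/(_ b); rewrite ab.
pose o1 : 'I_3 := @Ordinal 3 1 isT; pose o2 : 'I_3 := @Ordinal 3 2 isT.
have [[h1 h2] [h3 h4]] := (lt ord0 o1 isT, lt o1 o2 isT).
by move: (h (f ord0) (f o1) (f o2)); rewrite h1 h3 h2 h4 => /(_ isT).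
Qed.

Lemma ones_in_perm_mx (R : realType) (n : nat) (s : 'S_n)
    (Q : {set 'I_n * 'I_n}) :
  ones_in (perm_mx s : 'M[R]_n) Q = #|[set x | (x, s x) \in Q]|.
Proof.
rewrite /ones_in -(card_imset _ (_ : injective (fun x => (x, s x))));
  last by move=> x y [].
apply: eq_card => -[x y]; rewrite !inE /= !mxE; apply/andP/imsetP.
  case=> xyQ; case: (s x =P y) => [sxy _|_]; first by exists x;
    rewrite ?inE sxy.
  by rewrite eq_sym oner_eq0.
by case=> z; rewrite inE => zQ [-> ->]; rewrite zQ !eqxx.
Qed.

Lemma card_ord_le (N p : nat) : p <= N -> #|[set x : 'I_N.+1 | x <= p]| = p.+1.
Proof.
move=> pN; rewrite -[RHS]card_ord.
rewrite -(card_imset _ (_ : injective (widen_ord (pN : p < N.+1)))).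
  apply: eq_card => x; rewrite inE; apply/idP/imsetP => [xp|[y _ ->]];
    last exact: ltn_ord y.
  by exists (Ordinal (xp : x < p.+1)) => //; apply: val_inj.
by move=> x y /(congr1 val)/= /val_inj.
Qed.

Lemma card_ord_gt (N p : nat) : p <= N -> #|[set x : 'I_N.+1 | p < x]| = N - p.
Proof.
move=> pN; have := cardsC [set x : 'I_N.+1 | x <= p].
rewrite card_ord_le // card_ord.
have -> : ~: [set x : 'I_N.+1 | x <= p] = [set x : 'I_N.+1 | p < x].
  by apply/setP => x; rewrite !inE ltnNge.
lia.
Qed.

(** Rows [<= p] carry [p + 1] ones and columns [> q] carry [N - q = p]; both counts contain the
    block of rows [<= p] and columns [> q], which cancels. *)
Lemma card_corner_balance (N p q : nat) (s : 'S_N.+1) : p + q = N ->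
  #|[set x : 'I_N.+1 | (x <= p) && (s x <= q)]| =
    #|[set x : 'I_N.+1 | (p < x) && (q < s x)]|.+1.
Proof.
move=> pq.
have e1 : #|[set x : 'I_N.+1 | x <= p]| = p.+1 by rewrite card_ord_le //; lia.
have e2 : #|[set x | q < s x]| = p.
  have -> : [set x | q < s x] =
    s @^-1: [set y : 'I_N.+1 | q < y] by apply/setP => x; rewrite !inE.
  rewrite card_preimset ?card_ord_gt; [lia|lia|exact: perm_inj].
rewrite -(cardsID [set x | s x <= q]) in e1.
rewrite -(cardsID [set x : 'I_N.+1 | p < x]) in e2.
have e3 : [set x : 'I_N.+1 | x <= p] :\: [set x | s x <= q] =
  [set x | q < s x] :\: [set x : 'I_N.+1 | p < x].
  by apply/setP => x; rewrite !inE -!leqNgt -ltnNge andbC.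
have e4 : [set x : 'I_N.+1 | x <= p] :&: [set x | s x <= q] =
  [set x : 'I_N.+1 | (x <= p) && (s x <= q)].
  by apply/setP => x; rewrite !inE.
have e5 : [set x | q < s x] :&: [set x : 'I_N.+1 | p < x] =
  [set x : 'I_N.+1 | (p < x) && (q < s x)].
  by apply/setP => x; rewrite !inE andbC.
rewrite e3 e4 in e1; rewrite e5 in e2.
by apply: (addIn (etrans e1 _)); rewrite addSn e2.
Qed.

Lemma face_perms_rectangle (R : realType) (N p q : nat) (s : 'S_N.+1) :
  p + q = N ->
  (s \in face_perms R (flag_blocker N.+1 q.+1 (q.+1 - 1))) =
  avoids123 (perm_mx s : 'M[R]_N.+1) &&
    [forall x : 'I_N.+1, (p < x) ==> (s x <= q)].
Proof.
move=> pq; rewrite inE ones_in_perm_mx; congr andb.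
(* For [t = m - 1] both pieces of the flag have [p + 1] rows, and together they cover columns 0 to
   [q]. *)
have -> : [set x | (x, s x) \in flag_blocker N.+1 q.+1 (q.+1 - 1)] =
  [set x : 'I_N.+1 | (x <= p) && (s x <= q)].
  by apply/setP => x; rewrite !inE /=; lia.
rewrite card_corner_balance // eqSS cards_eq0;
  apply/eqP/forallP => [/setP h x|h].
  by move: (h x); rewrite !inE; lia.
by apply/setP => x; move: (h x); rewrite !inE; lia.
Qed.

Lemma exch_face (R : realType) (N p q j i k u v : nat) :
  exch_admissible N p q j i k u v ->
  exists2 s, s \in face_perms R (flag_blocker N.+1 q.+1 (q.+1 - 1)) &
    forall x : 'I_N.+1, s x = exch N j i k u v x :> nat.
Proof.
move=> adm; pose f (x : 'I_N.+1) : 'I_N.+1 := inord (exch N j i k u v x).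
have leN (x : 'I_N.+1) : x <= N by rewrite -ltnS.
have fE x : f x = exch N j i k u v x :> nat
  by rewrite inordK // ltnS (exch_le adm).
have fI : injective f.
  by move=> x y /(congr1 val); rewrite /= !fE => /(exch_inj adm) h;
    apply/val_inj/h.
exists (perm fI) => [|x]; last by rewrite permE.
have [pq _ _ _ _] := adm; rewrite (face_perms_rectangle _ _ pq); apply/andP;
  split.
  by apply: avoids123_perm_mx => x y z xyz;
    rewrite !permE !fE (exch_avoids adm).
by apply/forallP => x; apply/implyP => px; rewrite permE fE (exch_corner adm).
Qed.

(** Exchanges need [i + j < N], so there are none when [N = 0]; the decreasing permutation is a
    member of the face for every [N]. *)
Lemma rev_face (R : realType) (N p q : nat) : p + q = N ->
  perm (@rev_ord_inj N.+1) \in face_perms R (flag_blocker N.+1 q.+1 (q.+1 - 1)).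
Proof.
move=> pq; rewrite (face_perms_rectangle _ _ pq); apply/andP; split.
  by apply: avoids123_perm_mx => x y z xyz; rewrite !permE /=; lia.
by apply/forallP => x; apply/implyP; rewrite permE /=; lia.
Qed.

(** * Functionals vanishing on the face *)

Section Functional.
Context {R : realType} {N p q : nat} (pq : p + q = N)
  {W : 'I_N.+1 -> 'I_N.+1 -> R}.
Hypothesis W0 : forall s : 'S_N.+1,
  s \in face_perms R (flag_blocker N.+1 q.+1 (q.+1 - 1)) ->
    (\sum_x W x (s x))%R = 0%R.
Local Notation w x y := (W (inord x) (inord y)).

Lemma annihilator_exch j i k : i + j < N <= k + j -> k <= N ->
  (q <= j -> k <= p) ->
  (w i j - w i j.+1 = w k j - w k j.+1)%R.
Proof.
move=> ijk kN kp.
have [s sF sE] := @exch_face R N p q j i k j j.+1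
  (And5 pq ijk kN kp (or_introl (conj erefl erefl))).
have [t tF tE] := @exch_face R N p q j i k j.+1 j
  (And5 pq ijk kN kp (or_intror (conj erefl erefl))).
(* [s] and [t] agree outside rows [i] and [k], so only four terms survive. *)
have : (\sum_x W x (s x) - \sum_x W x (t x) = 0)%R by rewrite !W0 // subrr.
have ik : (inord k : 'I_N.+1) != inord i by apply/negP => /eqP/(congr1 val);
  rewrite /= !inordK; lia.
rewrite -sumrB (bigD1 (inord i)) //= (bigD1 (inord k)) //= big1 =>
  [|x /andP[xi xk]].
  have vI y (z : 'I_N.+1) : z = y :> nat -> z = inord y by move=> <-;
    rewrite inord_val.
  have := sE (inord i); have := sE (inord k); have := tE (inord i);
    have := tE (inord k).
  rewrite /exch !inordK ?eqxx; try lia.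
  have -> : (k == i) = false by lia.
  move=> /vI -> /vI -> /vI -> /vI -> e.
  by apply/eqP; rewrite -subr_eq0; apply/eqP; rewrite -[RHS]e; ring.
rewrite (_ : s x = t x) ?subrr //; apply: val_inj; rewrite /= sE tE /exch.
have neq y : y <= N -> x != inord y -> (x == y :> nat) = false.
  by move=> yN /negP xy; apply/eqP => e; apply: xy; rewrite -e inord_val.
by rewrite !neq //; lia.
Qed.

Lemma annihilator_step j i : j < N -> i <= N -> (q <= j -> i <= p) ->
  (w i j - w i j.+1 = w (N - j) j - w (N - j) j.+1)%R.
Proof.
move=> jN iN ip; have [ij|ij] := ltnP (i + j) N;
  first by apply: annihilator_exch; lia.
(* Here [i] and [N - j] are on the same side of the bipartite graph; both are joined to row 0. *)
rewrite -(@annihilator_exch j 0 i) -?(@annihilator_exch j 0 (N - j)) //; lia.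
Qed.

(** The differences telescope along the columns: a position off the corner has all positions to its
    left off the corner too. *)
Lemma annihilator_additive i j : i <= N -> j <= N -> (i <= p) || (j <= q) ->
  (w i j - w i 0 = w 0 j - w 0 0)%R.
Proof.
move=> iN; elim: j => [|j IH] jN ijpq; first by rewrite !subrr.
have e1 : (w i j - w i j.+1 = w 0 j - w 0 j.+1)%R.
  by rewrite !annihilator_step //; lia.
have e2 := IH (ltnW jN) ltac:(lia).
have -> : (w i j.+1 - w i 0 = (w i j - w i 0) - (w i j - w i j.+1))%R by ring.
by rewrite e1 e2; ring.
Qed.

End Functional.

(** * Coordinates for the span of the face *)

(* Outside the corner, the removed positions lie in column 0 and row 1; as edges
   between rows and columns they form a tree joining all lines except row 0. *)
Definition face_coords (N p q : nat) : {set 'I_N.+1 * 'I_N.+1} :=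
  [set t : 'I_N.+1 * 'I_N.+1 |
    ~~ [|| (p < t.1) && (q < t.2), (0 < t.1) && (t.2 == 0 :> nat)
         | (t.1 == 1 :> nat) && (0 < t.2)]].

Lemma card_face_coords (N p q : nat) : p + q = N ->
  #|face_coords N p q| = N ^ 2 + 1 - q * p.
Proof.
move=> pq.
pose B1 := setX [set x : 'I_N.+1 | p < x] [set y : 'I_N.+1 | q < y].
pose B2 := setX [set x : 'I_N.+1 | 0 < x] [set y : 'I_N.+1 | y <= 0].
pose B3 := setX [set x : 'I_N.+1 | x == 1 :> nat] [set y : 'I_N.+1 | 0 < y].
have -> : face_coords N p q = ~: (B1 :|: (B2 :|: B3)).
  by apply/setP => -[x y]; rewrite !inE leqn0.
have c1 : #|B1| = q * p by rewrite cardsX !card_ord_gt;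
  [congr muln; lia|lia|lia].
have c2 : #|B2| = N by rewrite cardsX card_ord_gt // card_ord_le // subn0 muln1.
have c3 : #|B3| = N.
  (* For [N = 0] there is no row 1, but no positive column either. *)
  rewrite cardsX card_ord_gt // subn0; case: N {B1 B2 B3 pq c1 c2} => [|M];
    first by rewrite muln0.
  rewrite (_ : [set x : 'I_M.+2 | x == 1 :> nat] =
    [set inord 1]) ?cards1 ?mul1n //.
  by apply/setP => x; rewrite !inE -val_eqE /= inordK.
have := cardsC (B1 :|: (B2 :|: B3)).
rewrite !cardsU c1 c2 c3 card_prod card_ord.
have -> : B2 :&: B3 = set0 by apply/setP => -[x y]; rewrite !inE /=; lia.
(* If row 1 is below row [p], then [p = 0] and [q = N], so no column exceeds [q]. *)
have -> : B1 :&: (B2 :|: B3) = set0 by apply/setP => -[x y];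
  move: (ltn_ord y); rewrite !inE /=; lia.
rewrite !cards0 !subn0 => /(canRL (addKn _)) ->; lia.
Qed.

(** Row 0 lies entirely in [face_coords], so the common line sum is 0. Column sums then kill the
    rest of row 1, and row sums kill column 0. *)
Lemma face_coords_determine (R : realType) (N p q d : nat)
    (f : 'I_d -> 'S_N.+1) (c : 'I_d -> R) :
  p + q = N ->
  (forall a, f a \in face_perms R (flag_blocker N.+1 q.+1 (q.+1 - 1))) ->
  let X := (\sum_a c a *: perm_mx (f a))%R : 'M[R]_N.+1 in
  (forall t, t \in face_coords N p q -> X t.1 t.2 = 0%R) -> X = 0%R.
Proof.
move=> pq fF X X0.
have XE x y : X x y = (\sum_a c a * (f a x == y)%:R)%R.
  by rewrite summxE; apply: eq_bigr => a _; rewrite !mxE.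
have rowX x : (\sum_y X x y = \sum_a c a)%R.
  under eq_bigr do rewrite XE.
  rewrite exchange_big; apply: eq_bigr => a _;
    rewrite -mulr_sumr (bigD1 (f a x)) //= eqxx big1 ?addr0 ?mulr1 //.
  by move=> y; rewrite eq_sym => /negPf ->.
have colX y : (\sum_x X x y = \sum_a c a)%R.
  under eq_bigr do rewrite XE.
  rewrite exchange_big; apply: eq_bigr => a _;
    rewrite -mulr_sumr (bigD1 ((f a)^-1 y)%g) //= permKV eqxx big1 ?addr0
    ?mulr1 //.
  by move=> x /negPf xy; rewrite -(inj_eq (@perm_inj _ (f a)^-1)%g) permK xy.
have XT (x y : 'I_N.+1) : ~~ ((0 < x) && (y == 0 :> nat)) ->
  ~~ ((x == 1 :> nat) && (0 < y)) -> X x y = 0%R.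
  move=> h1 h2; have [/andP[px qy]|h3] := boolP ((p < x) && (q < y)).
    rewrite XE big1 // => a _; have := fF a;
      rewrite (face_perms_rectangle _ _ pq).
    case/andP=> _ /forallP/(_ x); rewrite px /= => sq.
    by rewrite (_ : _ == y = false) ?mulr0 //; apply/eqP => e; move: sq;
      rewrite e leqNgt qy.
  by apply: (X0 (x, y)); rewrite inE /= !negb_or h1 h2 h3.
have c0 : (\sum_a c a = 0)%R.
  by rewrite -(rowX ord0) big1 // => y _; apply: XT; rewrite ?ltnn.
have X1 (x y : 'I_N.+1) : (0 < y) -> X x y = 0%R.
  move=> y0; have [x1|/negP x1] := eqVneq (x : nat) 1; last by apply: XT; lia.
  have := colX y; rewrite c0 (bigD1 x) //= big1 ?addr0 // => z zx.
  by apply: XT; move: zx; rewrite -val_eqE /=; lia.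
apply/matrixP => x y; rewrite [RHS]mxE.
case: (posnP y) => [y0|]; last exact: X1.
have := rowX x; rewrite c0 (bigD1 y) //= big1 ?addr0 // => z zy.
by apply: X1; move: zy; rewrite -val_eqE /=; lia.
Qed.

Lemma face_coords_separated (R : realType) (N p q : nat)
    (W : 'I_N.+1 * 'I_N.+1 -> R) :
  p + q = N ->
  (forall s, s \in face_perms R (flag_blocker N.+1 q.+1 (q.+1 - 1)) ->
     (\sum_(t in face_coords N p q) W t * (perm_mx s : 'M[R]_N.+1) t.1 t.2)%R =
       0%R) ->
  forall t, t \in face_coords N p q -> W t = 0%R.
Proof.
move=> pq W0.
pose V x y := if (x, y) \in face_coords N p q then W (x, y) else 0%R.
have V0 (s : 'S_N.+1) :
    s \in face_perms R (flag_blocker N.+1 q.+1 (q.+1 - 1)) ->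
    (\sum_x V x (s x))%R = 0%R.
  move=> /W0 e; rewrite -[RHS]e [RHS]big_mkcond.
  (* Each term is spread over the indicators of the graph of [s], so that exchanging the sums leaves
     one term per row. *)
  rewrite [RHS](eq_bigr (fun t =>
    (\sum_x if t == (x, s x) then V x (s x) else 0)%R)).
    rewrite [RHS]exchange_big; apply: eq_bigr => x _.
    by rewrite -big_mkcond big_pred1_eq.
  case=> x y _ /=; rewrite (bigD1 x) //= big1 => [|z /negPf zx].
    rewrite addr0 xpair_eqE eqxx /= /V !mxE eq_sym.
    by case: eqP => [->|_]; case: ifP; rewrite ?mulr1 ?mulr0.
  by rewrite xpair_eqE eq_sym zx.
have add (x y : 'I_N.+1) : (x <= p) || (y <= q) ->
    (V x y - V x ord0 = V ord0 y - V ord0 ord0)%R.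
  have := @annihilator_additive R N p q pq V V0 x y (ltn_ord x) (ltn_ord y).
  by rewrite !inord_val (_ : inord 0 = ord0) //; apply: val_inj;
    rewrite /= inordK.
(* [V] vanishes on row 1, where no coordinates lie, so comparing row 1 with row 0 makes row 0
   constant. *)
have V00 y : V ord0 y = V ord0 ord0.
  have [->//|y0] := eqVneq y ord0.
  have N0 : 0 < N by move: y0 (ltn_ord y); rewrite -val_eqE /=; lia.
  have i1 : (inord 1 : 'I_N.+1) = 1 :> nat by rewrite inordK.
  have := add (inord 1) y; rewrite i1 => /(_ ltac:(move: (ltn_ord y); lia)).
  rewrite /V !inE !i1 /= ltn0 /= andbF /=.
  rewrite (_ : 0 < y); last by move: y0; rewrite -val_eqE /=; lia.
  by rewrite !orbT /= subrr => /eqP; rewrite eq_sym subr_eq0 => /eqP.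
have Vpos (x y : 'I_N.+1) : 0 < x -> (x, y) \in face_coords N p q ->
  V x y = 0%R.
  move=> x0 xyT; have := add x y; rewrite V00 subrr.
  have -> : V x ord0 = 0%R by rewrite /V inE /= x0 orbT.
  by rewrite subr0 => -> //; move: xyT; rewrite inE /=; lia.
(* Along the decreasing permutation only the term of row 0 can be nonzero. *)
have V000 : V ord0 ord0 = 0%R.
  have := V0 _ (rev_face R pq);
    rewrite (bigD1 ord0) //= V00 big1 ?addr0 // => x x0.
  have [xT|/negPf nT] :=
    boolP ((x, perm (@rev_ord_inj N.+1) x) \in face_coords N p q).
    by apply: Vpos => //; rewrite lt0n; move: x0; rewrite -val_eqE.
  by rewrite /V nT.
case=> x y xyT; have -> : W (x, y) = V x y by rewrite /V xyT.
have [x0|x0] := posnP x; last exact: Vpos.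
by rewrite (_ : x = ord0) ?V00 //; apply: val_inj.
Qed.

Theorem theorem4p6 (R : realType) (n m : nat) (hn : 1 <= n)
    (hm1 : 1 <= m) (hmn : m <= n) :
  face_dim R (flag_blocker n m (m - 1))
  = (n - 1) ^ 2 + 1 - (m - 1) * (n - m).
Proof.
case: n hn hmn => // N _ hmn; case: m hm1 hmn => // q _ qN.
have pq : (N - q) + q = N by lia.
rewrite /face_dim (max_free_coordinates (T := face_coords N (N - q) q)).
- by rewrite card_face_coords // !subn1 subSS.
- by move=> d f c fF; apply: face_coords_determine.
- by move=> W W0; apply: face_coords_separated.
Qed.
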